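(* Let $p:\mathscr{E}\to\mathscr{B}$ be a functor equipped with a quotient structure with section, i.e. a section $\star:\mathscr{B}\to\mathscr{E}$ of $p$ with left adjoint $[\![-]\!]:\mathscr{E}\to\mathscr{B}$. Let $F:\mathscr{B}\to\mathscr{B}$ and $G:\mathscr{E}\to\mathscr{E}$ be endofunctors, and let $\delta:p\circ G\Rightarrow F\circ p$ and $\sigma:\star\circ F\Rightarrow G\circ\star$ be natural transformations such that (1) the composite $F=p\circ\star\circ F\xRightarrow{\ p\circ\sigma\ }p\circ G\circ\star\xRightarrow{\ \delta\circ\star\ }F\circ p\circ\star=F$ is the identity, and (2) $\sigma$ is invertible. Then the quotient structure with section $\star:\mathscr{B}\to\mathscr{E}$ lifts to a quotient structure with section $\star:\mathbf{CoAlg}_F(\mathscr{B})\to\mathbf{CoAlg}_G(\mathscr{E})$ on the functor $\mathbf{CoAlg}(p):\mathbf{CoAlg}_G(\mathscr{E})\to\mathbf{CoAlg}_F(\mathscr{B})$: the lifted functor $\star$ is a section of $\mathbf{CoAlg}(p)$ and is right adjoint to the lifted quotient functor $[\![-]\!]:\mathbf{CoAlg}_G(\mathscr{E})\to\mathbf{CoAlg}_F(\mathscr{B})$. Consequently, if the terminal $F$-coalgebra $\nu F$ exists, then $\star$ transports it to the terminal $G$-coalgebra: $\nu G=\star_{\nu F}$.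
   Context: A section of $p:\mathscr{E}\to\mathscr{B}$ is a functor $\star:\mathscr{B}\to\mathscr{E}$, $A\mapsto\star_A$, with $p\circ\star=\mathrm{id}_{\mathscr{B}}$. A quotient structure with section on $p$ is a section of $p$ together with a left adjoint of that section. For an endofunctor $F$ on $\mathscr{B}$, $\mathbf{CoAlg}_F(\mathscr{B})$ is the category of $F$-coalgebras $(A,a:A\to FA)$ and coalgebra morphisms; similarly $\mathbf{CoAlg}_G(\mathscr{E})$. The functor $\mathbf{CoAlg}(p)$ sends a $G$-coalgebra $(R,r:R\to GR)$ to $(pR,\ \delta_R\circ p(r):pR\to FpR)$ and acts as $p$ on morphisms. The lifted section sends an $F$-coalgebra $(A,a)$ to $(\star_A,\ \sigma_A\circ\star_a:\star_A\to G\star_A)$ and acts as $\star$ on morphisms. The lifted quotient functor sends $(R,r)$ to $([\![R]\!],\ \widetilde{\sigma}_R\circ[\![r]\!]:[\![R]\!]\to F[\![R]\!])$ and acts as $[\![-]\!]$ on morphisms, where $\widetilde{\sigma}:[\![-]\!]\circ G\Rightarrow F\circ[\![-]\!]$ is the mate of $\sigma^{-1}$, i.e. the composite $$[\![G(-)]\!]\xRightarrow{\ [\![G\eta]\!]\ }[\![G\star_{[\![-]\!]}]\!]\xRightarrow{\ [\![\sigma^{-1}]\!]\ }[\![\star_{F[\![-]\!]}]\!]\xRightarrow{\ \varepsilon\ }F[\![-]\!],$$ with $\eta,\varepsilon$ the unit and counit of $[\![-]\!]\dashv\star$. *)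

(* Defs.v *)
(* Hom-sets are types with Leibniz equality; proof irrelevance identifies
   coalgebra morphisms with the same underlying arrow. *)
From Stdlib Require Import ProofIrrelevance.

Set Implicit Arguments.
Unset Strict Implicit.
Unset Printing Implicit Defensive.

Declare Scope cat_scope.
Delimit Scope cat_scope with cat.
Reserved Notation "g ∘ f" (at level 40, left associativity).

Record category := Category {
  ob :> Type;
  hom : ob -> ob -> Type;
  idm : forall x, hom x x;
  comp : forall x y z, hom y z -> hom x y -> hom x z;
  comp_idl : forall x y (f : hom x y), comp (idm y) f = f;
  comp_idr : forall x y (f : hom x y), comp f (idm x) = f;
  comp_assoc : forall x y z w (h : hom z w) (g : hom y z) (f : hom x y),
    comp (comp h g) f = comp h (comp g f)
}.
Arguments hom {c} x y.
Arguments idm {c} x.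
Arguments comp {c x y z} g f.

Notation "g ∘ f" := (comp g f) : cat_scope.
Open Scope cat_scope.

Record functor (C D : category) := Functor {
  fobj :> C -> D;
  fmap : forall x y, hom x y -> hom (fobj x) (fobj y);
  fmap_id : forall x, fmap (idm x) = idm (fobj x);
  fmap_comp : forall x y z (g : hom y z) (f : hom x y),
    fmap (g ∘ f) = fmap g ∘ fmap f
}.
Arguments fmap {C D} F {x y} f : rename.

Definition fid (C : category) : functor C C :=
  {| fobj := fun x => x;
     fmap := fun x y f => f;
     fmap_id := fun x => eq_refl;
     fmap_comp := fun x y z g f => eq_refl |}.

Definition fcomp (C D E : category) (K : functor D E) (H : functor C D) :
  functor C E.
Proof.
refine {| fobj := fun x => K (H x);
          fmap := fun x y f => fmap K (fmap H f) |}.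
- intros x; rewrite fmap_id; apply fmap_id.
- intros x y z g f; rewrite fmap_comp; apply fmap_comp.
Defined.

Record nat_trans (C D : category) (H K : functor C D) := NatTrans {
  nt :> forall x : C, hom (H x) (K x);
  nt_natural : forall x y (f : hom x y), nt y ∘ fmap H f = fmap K f ∘ nt x
}.

Definition nt_id (C D : category) (H : functor C D) : nat_trans H H.
Proof.
refine {| nt := fun x => idm (H x) |}.
intros x y f; rewrite comp_idl, comp_idr; reflexivity.
Defined.

(* A strict equality of functors read as a natural transformation, all of whose
   components are identities up to transport along the equality. *)
Definition eq_nt (C D : category) (H K : functor C D) (e : H = K) :
  nat_trans H K :=
  match e in _ = K0 return nat_trans H K0 with eq_refl => nt_id H end.

Record nt_inverse (C D : category) (H K : functor C D) (s : nat_trans H K) :=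
  NtInverse {
    nt_inv :> nat_trans K H;
    nt_invl : forall x, nt_inv x ∘ s x = idm (H x);
    nt_invr : forall x, s x ∘ nt_inv x = idm (K x)
  }.

Record adjunction (C D : category) (L : functor C D) (R : functor D C) :=
  Adjunction {
    adj_unit : nat_trans (fid C) (fcomp R L);
    adj_counit : nat_trans (fcomp L R) (fid D);
    adj_triangle_l : forall x : C,
      adj_counit (L x) ∘ fmap L (adj_unit x) = idm (L x);
    adj_triangle_r : forall y : D,
      fmap R (adj_counit y) ∘ adj_unit (R y) = idm (R y)
  }.

Definition is_terminal (C : category) (t : C) : Prop :=
  forall x : C, exists f : hom x t, forall g : hom x t, g = f.

(* [star] is a strict section of [p], and [quot] is its left adjoint. *)
Record quotient_structure (E B : category) (p : functor E B)
    (star : functor B E) (quot : functor E B) := QuotientStructure {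
  qs_section : fcomp p star = fid B;
  qs_adj : adjunction quot star
}.

Record coalg (C : category) (F : functor C C) := Coalg {
  carrier : C;
  costr : hom carrier (F carrier)
}.
Arguments Coalg {C F} carrier costr.

Record coalg_hom (C : category) (F : functor C C) (X Y : coalg F) := CoalgHom {
  chom : hom (carrier X) (carrier Y);
  chom_comm : fmap F chom ∘ costr X = costr Y ∘ chom
}.

Lemma coalg_hom_eq (C : category) (F : functor C C) (X Y : coalg F)
  (f g : coalg_hom X Y) : chom f = chom g -> f = g.
Proof.
destruct f as [f Hf], g as [g Hg]; cbn; intros e; subst g.
f_equal; apply proof_irrelevance.
Qed.

Definition coalg_id (C : category) (F : functor C C) (X : coalg F) :
  coalg_hom X X.
Proof.
refine {| chom := idm (carrier X) |}.
rewrite fmap_id, comp_idl, comp_idr; reflexivity.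
Defined.

Definition coalg_comp (C : category) (F : functor C C) (X Y Z : coalg F)
  (g : coalg_hom Y Z) (f : coalg_hom X Y) : coalg_hom X Z.
Proof.
refine {| chom := chom g ∘ chom f |}.
rewrite fmap_comp, comp_assoc, chom_comm, <- comp_assoc, chom_comm.
apply comp_assoc.
Defined.

Definition CoAlg (C : category) (F : functor C C) : category.
Proof.
refine {| ob := coalg F;
          hom := @coalg_hom C F;
          idm := @coalg_id C F;
          comp := @coalg_comp C F |}.
- intros X Y f; apply coalg_hom_eq, comp_idl.
- intros X Y f; apply coalg_hom_eq, comp_idr.
- intros X Y Z W h g f; apply coalg_hom_eq, comp_assoc.
Defined.

(* A functor [K] with a natural transformation [t : K A ⇒ A' K] induces
   (X, x) |-> (K X, t_X ∘ K x) on coalgebras. *)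
Definition coalg_lift_ob (C D : category) (A : functor C C) (A' : functor D D)
  (K : functor C D) (t : nat_trans (fcomp K A) (fcomp A' K)) (X : coalg A) :
  coalg A' :=
  {| carrier := K (carrier X);
     costr := t (carrier X) ∘ fmap K (costr X) |}.

Definition coalg_lift_hom (C D : category) (A : functor C C)
  (A' : functor D D) (K : functor C D)
  (t : nat_trans (fcomp K A) (fcomp A' K)) (X Y : coalg A)
  (f : coalg_hom X Y) : coalg_hom (coalg_lift_ob t X) (coalg_lift_ob t Y).
Proof.
refine {| chom := fmap K (chom f)
            : hom (carrier (coalg_lift_ob t X)) (carrier (coalg_lift_ob t Y)) |}.
cbn; rewrite <- comp_assoc.
pose proof (nt_natural t (chom f)) as e; cbn in e; rewrite <- e.
rewrite !comp_assoc, <- !fmap_comp, chom_comm; reflexivity.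
Defined.

Definition coalg_lift (C D : category) (A : functor C C) (A' : functor D D)
  (K : functor C D) (t : nat_trans (fcomp K A) (fcomp A' K)) :
  functor (CoAlg A) (CoAlg A').
Proof.
refine (@Functor (CoAlg A) (CoAlg A')
  (coalg_lift_ob t) (@coalg_lift_hom _ _ _ _ _ t) _ _).
- intros X; apply coalg_hom_eq, fmap_id.
- intros X Y Z g f; apply coalg_hom_eq, fmap_comp.
Defined.

(* The mate of [s = σ⁻¹]: ε_{F[[R]]} ∘ [[σ⁻¹_{[[R]]}]] ∘ [[G η_R]]. *)
Definition mate (E B : category) (F : functor B B) (G : functor E E)
  (star : functor B E) (quot : functor E B) (adj : adjunction quot star)
  (s : nat_trans (fcomp G star) (fcomp star F)) :
  nat_trans (fcomp quot G) (fcomp F quot).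
Proof.
refine {| nt := fun R : E =>
  (adj_counit adj (F (quot R))
     ∘ fmap quot (s (quot R))
     ∘ fmap quot (fmap G (adj_unit adj R))
   : hom (fcomp quot G R) (fcomp F quot R)) |}.
intros R S f; cbn.
pose proof (nt_natural (adj_unit adj) f) as eU.
pose proof (nt_natural s (fmap quot f)) as eS.
pose proof (nt_natural (adj_counit adj) (fmap F (fmap quot f))) as eC.
cbn in eU, eS, eC.
rewrite !comp_assoc, <- !fmap_comp, eU, (fmap_comp G).
rewrite <- (comp_assoc (s (quot S))); cbn; rewrite eS.
rewrite comp_assoc, fmap_comp, <- !comp_assoc; cbn; rewrite eC; reflexivity.
Defined.

(* Main.v *)
(* Hypothesis (1) says that transport along [p star = id] carries the lifted
   coalgebra structure on [p star A] to that of [A], so the section equation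
   holds strictly.  The mate of σ⁻¹ is exactly what makes the unit and counit
   of the adjunction coalgebra morphisms; the triangle identities are then
   inherited, since coalgebra morphisms are compared on underlying arrows. *)
From Stdlib Require Import FunctionalExtensionality ProofIrrelevance.
Require Import Defs.

Set Implicit Arguments.
Unset Strict Implicit.
Unset Printing Implicit Defensive.

(** Turning an object equality into an arrow lets strict equalities be stated as commuting squares,
    with no transported arrows. *)
Definition id_to (C : category) (x y : C) (e : x = y) : hom x y :=
  match e in _ = z return hom x z with eq_refl => idm x end.

Lemma functor_ext (C D : category) (H K : functor C D)
  (e : forall x, H x = K x) :
  (forall x y (f : hom x y),
     id_to (e y) ∘ fmap H f = fmap K f ∘ id_to (e x)) ->
  H = K.
Proof.
destruct H as [Ho Hm Hi Hc], K as [Ko Km Ki Kc]; cbn in *; intros nat.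
assert (eo : Ho = Ko) by (apply functional_extensionality; exact e).
subst Ko.
assert (em : Hm = Km).
{ apply functional_extensionality_dep; intros x.
  apply functional_extensionality_dep; intros y.
  apply functional_extensionality_dep; intros f.
  specialize (nat x y f).
  (* The object maps now coincide, so each [e x] may be replaced by [eq_refl] and the square
     collapses to an equality of arrows. *)
  rewrite (proof_irrelevance _ (e x) eq_refl),
    (proof_irrelevance _ (e y) eq_refl) in nat; cbn in nat.
  now rewrite comp_idl, comp_idr in nat. }
subst Km.
now rewrite (proof_irrelevance _ Hi Ki), (proof_irrelevance _ Hc Kc).
Qed.

Lemma eq_nt_id_to (C D : category) (H K : functor C D) (e : H = K)
  (e' : forall x, H x = K x) (x : C) : eq_nt e x = id_to (e' x).
Proof.
destruct e; rewrite (proof_irrelevance _ (e' x) eq_refl); reflexivity.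
Qed.

Lemma eq_nt_symK (C D : category) (H K : functor C D) (e : H = K) (x : C) :
  eq_nt (eq_sym e) x ∘ eq_nt e x = idm (H x).
Proof. destruct e; apply comp_idl. Qed.

Lemma coalg_eq (C : category) (F : functor C C) (X Y : coalg F)
  (e : carrier X = carrier Y) :
  fmap F (id_to e) ∘ costr X = costr Y ∘ id_to e -> X = Y.
Proof.
destruct X as [c a], Y as [d b]; cbn in *; destruct e; cbn.
rewrite fmap_id, comp_idl, comp_idr; intros ab; now subst b.
Qed.

(** Equalities of coalgebras are opaque here; this allows comparing their arrows through the
    carriers alone. *)
Lemma chom_id_to (C : category) (F : functor C C) (X Y : CoAlg F) (h : X = Y)
  (e : carrier X = carrier Y) : chom (id_to h) = id_to e.
Proof.
destruct h; rewrite (proof_irrelevance _ e eq_refl); reflexivity.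
Qed.

Lemma coalg_lift_section (E B : category) (p : functor E B)
  (star : functor B E) (e : fcomp p star = fid B)
  (F : functor B B) (G : functor E E)
  (delta : nat_trans (fcomp p G) (fcomp F p))
  (sigma : nat_trans (fcomp star F) (fcomp G star)) :
  (forall A : B,
     fmap F (eq_nt e A) ∘ delta (star A) ∘ fmap p (sigma A)
       ∘ eq_nt (eq_sym e) (F A) = idm (F A)) ->
  fcomp (coalg_lift delta) (coalg_lift sigma) = fid (CoAlg F).
Proof.
intros Hsection.
assert (eo : forall A, fcomp p star A = fid B A) by (intros A; now rewrite e).
(* Hypothesis (1) with its trailing inverse transport cancelled. *)
assert (key : forall A, fmap F (eq_nt e A) ∘ delta (star A) ∘ fmap p (sigma A)
                        = eq_nt e (F A)).
{ intros A.
  pose proof (f_equal (fun u => u ∘ eq_nt e (F A)) (Hsection A)) as h.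
  pose proof (eq_nt_symK e (F A)) as k; cbn in h, k.
  rewrite comp_assoc, k, comp_idr, comp_idl in h; exact h. }
assert (eX : forall X : CoAlg F,
  fcomp (coalg_lift delta) (coalg_lift sigma) X = fid (CoAlg F) X).
{ intros X.
  refine (@coalg_eq B F (coalg_lift delta (coalg_lift sigma X)) X
            (eo (carrier X)) _).
  pose proof (eq_nt_id_to e eo (carrier X)) as u; cbn in u |- *; rewrite <- u.
  pose proof (nt_natural (eq_nt e) (costr X)) as n; cbn in n.
  rewrite <- n, <- key, fmap_comp, !comp_assoc; reflexivity. }
(* On underlying arrows, the remaining square is naturality of [eq_nt e] at [chom f]. *)
apply (functor_ext (e := eX)); intros X Y f; apply coalg_hom_eq.
pose proof (nt_natural (eq_nt e) (chom f)) as n.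
pose proof (eq_nt_id_to e eo) as u.
pose proof (chom_id_to (eX X) (eo (carrier X))) as iX.
pose proof (chom_id_to (eX Y) (eo (carrier Y))) as iY.
cbn in n, u, iX, iY |- *.
rewrite iX, iY, <- !u; exact n.
Qed.

Section Lifted_adjunction.
Variables (E B : category) (star : functor B E) (quot : functor E B).
Variable adj : adjunction quot star.
Variables (F : functor B B) (G : functor E E).
Variable sigma : nat_trans (fcomp star F) (fcomp G star).
Variable sigma_inv : nt_inverse sigma.

Let star_lift : functor (CoAlg F) (CoAlg G) := coalg_lift sigma.
Let quot_lift : functor (CoAlg G) (CoAlg F) :=
  coalg_lift (mate adj sigma_inv).

(** Transposing across the adjunction and back is the identity, by naturality of the unit and a
    triangle identity. *)
Lemma adj_transposeK (x : E) (b : B) (g : hom x (star b)) :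
  fmap star (adj_counit adj b ∘ fmap quot g) ∘ adj_unit adj x = g.
Proof.
pose proof (nt_natural (adj_unit adj) g) as n; cbn in n.
rewrite fmap_comp, comp_assoc; cbn; rewrite <- n, <- comp_assoc.
etransitivity; [ | apply comp_idl ].
exact (f_equal (fun u => u ∘ g) (adj_triangle_r adj b)).
Qed.

Lemma unit_coalg_hom (R : coalg G) :
  fmap G (adj_unit adj (carrier R)) ∘ costr R
  = costr (star_lift (quot_lift R)) ∘ adj_unit adj (carrier R).
Proof.
cbn.
rewrite !comp_assoc, <- !fmap_comp.
(* The structure map of [quot_lift R] is the transpose of σ⁻¹ ∘ G η ∘ r; transposing back leaves
   that arrow, and σ cancels σ⁻¹. *)
etransitivity; [ | symmetry; apply f_equal, adj_transposeK ].
rewrite <- !comp_assoc.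
pose proof (nt_invr sigma_inv (quot (carrier R))) as i; cbn in i.
cbn; rewrite i, comp_idl; reflexivity.
Qed.

Lemma counit_coalg_hom (X : coalg F) :
  fmap F (adj_counit adj (carrier X)) ∘ costr (quot_lift (star_lift X))
  = costr X ∘ adj_counit adj (carrier X).
Proof.
cbn; set (A := carrier X).
pose proof (nt_natural (adj_counit adj) (fmap F (adj_counit adj A))) as nF.
pose proof (nt_natural (adj_counit adj) (costr X)) as nX.
pose proof (nt_natural sigma_inv (adj_counit adj A)) as nS.
pose proof (adj_triangle_r adj A) as t.
pose proof (nt_invl sigma_inv A) as i.
cbn in nF, nX, nS, t, i; fold A in nX.
(* Naturality of ε puts ε at F A leftmost on both sides. What remains is the image under [quot] of
   an equation in [E]: sliding σ⁻¹ past F ε exposes the triangle inside G, after which σ⁻¹ meets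
   σ. *)
rewrite <- nX, <- !comp_assoc, <- nF, !comp_assoc; apply f_equal.
rewrite <- !fmap_comp; apply f_equal.
rewrite <- !comp_assoc; cbn; rewrite <- nS.
rewrite (comp_assoc (sigma_inv A)); cbn; rewrite <- fmap_comp.
rewrite t, fmap_id, comp_idr, i; apply comp_idl.
Qed.

Definition lifted_unit : nat_trans (fid (CoAlg G)) (fcomp star_lift quot_lift).
Proof.
refine (@NatTrans _ _ (fid (CoAlg G)) (fcomp star_lift quot_lift)
  (fun R => @CoalgHom _ _ R (star_lift (quot_lift R)) _ (unit_coalg_hom R)) _).
intros R S f; apply coalg_hom_eq; exact (nt_natural (adj_unit adj) (chom f)).
Defined.

Definition lifted_counit :
  nat_trans (fcomp quot_lift star_lift) (fid (CoAlg F)).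
Proof.
refine (@NatTrans _ _ (fcomp quot_lift star_lift) (fid (CoAlg F))
  (fun X => @CoalgHom _ _ (quot_lift (star_lift X)) X _
              (counit_coalg_hom X)) _).
intros X Y f; apply coalg_hom_eq; exact (nt_natural (adj_counit adj) (chom f)).
Defined.

Definition lifted_adjunction : adjunction quot_lift star_lift.
Proof.
refine (@Adjunction _ _ quot_lift star_lift lifted_unit lifted_counit _ _).
- intros R; apply coalg_hom_eq; exact (adj_triangle_l adj (carrier R)).
- intros X; apply coalg_hom_eq; exact (adj_triangle_r adj (carrier X)).
Defined.

End Lifted_adjunction.

Lemma right_adjoint_terminal (C D : category) (L : functor C D)
  (R : functor D C) (adj : adjunction L R) (t : D) :
  is_terminal t -> is_terminal (R t).
Proof.
intros ht x; destruct (ht (L x)) as [f hf].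
exists (fmap R f ∘ adj_unit adj x); intros g.
(* An arrow into [R t] is recovered from its transpose into [t], and that transpose must be [f]. *)
now rewrite <- (adj_transposeK adj g), (hf (adj_counit adj t ∘ fmap L g)).
Qed.

Theorem corollary10 (E B : category) (p : functor E B)
  (star : functor B E) (quot : functor E B)
  (Q : quotient_structure p star quot)
  (F : functor B B) (G : functor E E)
  (delta : nat_trans (fcomp p G) (fcomp F p))
  (sigma : nat_trans (fcomp star F) (fcomp G star))
  (Hsection : forall A : B,
     fmap F (eq_nt (qs_section Q) A)
       ∘ delta (star A)
       ∘ fmap p (sigma A)
       ∘ eq_nt (eq_sym (qs_section Q)) (F A)
     = idm (F A))
  (sigma_inv : nt_inverse sigma) :
  let CoAlg_p : functor (CoAlg G) (CoAlg F) := coalg_lift delta in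
  let star_lift : functor (CoAlg F) (CoAlg G) := coalg_lift sigma in
  let quot_lift : functor (CoAlg G) (CoAlg F) :=
    coalg_lift (mate (qs_adj Q) sigma_inv) in
  (exists Q' : quotient_structure CoAlg_p star_lift quot_lift,
     (forall R : CoAlg G,
        chom (adj_unit (qs_adj Q') R) = adj_unit (qs_adj Q) (carrier R)) /\
     (forall X : CoAlg F,
        chom (adj_counit (qs_adj Q') X) = adj_counit (qs_adj Q) (carrier X)))
  /\
  (forall nuF : CoAlg F, is_terminal nuF -> is_terminal (star_lift nuF)).
Proof.
intros CoAlg_p star_lift quot_lift.
pose (adj := lifted_adjunction (qs_adj Q) sigma_inv).
split.
- exists (QuotientStructure (coalg_lift_section Hsection) adj).
  (* The lifted unit and counit have the original components as underlying arrows by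
     construction. *)
  split; reflexivity.
- intros nuF; exact (@right_adjoint_terminal _ _ _ _ adj nuF).
Qed.
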